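(* Let $\mathbf{k}$ be a commutative unital ring, let $\kappa,\lambda\in\mathbf{k}$ and let $(A,\mu,\Delta)$ be a commutative infinitesimal bialgebra of weight $\lambda$ (i.e. an infinitesimal bialgebra of weight $\lambda$ whose multiplication $\mu$ is commutative). Define $$\rhd_\epsilon:A\otimes A\to A,\quad a\otimes b\mapsto a\rhd_\epsilon b:=\sum_{(b)}a\,b_{(1)}b_{(2)}+\kappa ab.$$ Then $(A,\rhd_\epsilon)$ is a pre-Lie algebra and a Novikov algebra.
   Context: An infinitesimal bialgebra of weight $\lambda$ is a triple $(A,\mu,\Delta)$ with $(A,\mu)$ an associative algebra (possibly without unit) and $(A,\Delta)$ a coassociative coalgebra (possibly without counit) such that $\Delta(ab)=a\cdot\Delta(b)+\Delta(a)\cdot b+\lambda(a\otimes b)$ for all $a,b\in A$, where $a\cdot(b\otimes c)=ab\otimes c$ and $(b\otimes c)\cdot a=b\otimes ca$. Sweedler notation: $\Delta(b)=\sum_{(b)}b_{(1)}\otimes b_{(2)}$. A (left) pre-Lie algebra is a $\mathbf{k}$-module $A$ with a bilinear operation $\rhd$ satisfying $(a\rhd b)\rhd c-a\rhd(b\rhd c)=(b\rhd a)\rhd c-b\rhd(a\rhd c)$ for all $a,b,c\in A$. A Novikov algebra is a (left) pre-Lie algebra $(A,\rhd)$ satisfying in addition $(a\rhd b)\rhd c=(a\rhd c)\rhd b$ for all $a,b,c\in A$. *)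

(* Defs.v *)
From HB Require Import structures.
From mathcomp Require Import all_boot all_order all_algebra.
From mathcomp Require Import generic_quotient boolp.

Set Implicit Arguments.
Unset Strict Implicit.
Unset Printing Implicit Defensive.

Import GRing.Theory.
Local Open Scope ring_scope.
Local Open Scope quotient_scope.

(* The library's {bilinear _ -> _ -> _} requires a nontrivial scalar ring;
   this version also covers the zero ring. *)
Definition bilinear_op (R : comPzRingType) (U V W : lmodType R)
    (f : U -> V -> W) : Prop :=
  (forall v, linear (f^~ v)) /\ (forall u, linear (f u)).

(* The tensor product of R-modules. A sequence [:: (m1, n1); ..; (mk, nk)]
   stands for the formal sum m1 (x) n1 + .. + mk (x) nk, and tensor_eq is the
   congruence generated by commutativity of the sum and the tensor relations.
   Formal sums only form a monoid, without cancellation, so that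
   0 (x) n = 0 has to be listed among the generators. *)
Inductive tensor_eq (R : comPzRingType) (M N : lmodType R) :
    seq (M * N) -> seq (M * N) -> Prop :=
| TensorRefl s : tensor_eq s s
| TensorSym s t : tensor_eq s t -> tensor_eq t s
| TensorTrans s t u : tensor_eq s t -> tensor_eq t u -> tensor_eq s u
| TensorCat s s' t t' :
    tensor_eq s s' -> tensor_eq t t' -> tensor_eq (s ++ t) (s' ++ t')
| TensorCatC s t : tensor_eq (s ++ t) (t ++ s)
| TensorAddl m m' n : tensor_eq [:: (m + m', n)] [:: (m, n); (m', n)]
| TensorAddr m n n' : tensor_eq [:: (m, n + n')] [:: (m, n); (m, n')]
| TensorScale a m n : tensor_eq [:: (a *: m, n)] [:: (m, a *: n)]
| TensorZero n : tensor_eq [:: (0, n)] [::].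

Section Tensor.
Variables (R : comPzRingType) (M N : lmodType R).
Implicit Types (s t : seq (M * N)) (a : R) (m : M) (n : N).

Definition tensor_eqb : rel (seq (M * N)) :=
  fun s t => `[< tensor_eq s t >].

Lemma tensor_eqb_refl : reflexive tensor_eqb.
Proof. by move=> s; apply/asboolP; apply: TensorRefl. Qed.

Lemma tensor_eqb_sym : symmetric tensor_eqb.
Proof. by move=> s t; apply/asboolP/asboolP => h; apply: TensorSym. Qed.

Lemma tensor_eqb_trans : transitive tensor_eqb.
Proof.
move=> t s u /asboolP h /asboolP h'; apply/asboolP; exact: TensorTrans h h'.
Qed.

Definition tensor_equiv :=
  EquivRel tensor_eqb tensor_eqb_refl tensor_eqb_sym tensor_eqb_trans.

Definition tensor : Type := {eq_quot tensor_equiv}.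

HB.instance Definition _ := Choice.on tensor.
HB.instance Definition _ := Quotient.on tensor.

Definition tensor_class s : tensor := \pi_tensor s.

Lemma tensor_classP s t : tensor_class s = tensor_class t <-> tensor_eq s t.
Proof.
split=> [/eqmodP/asboolP // | h]; first by apply/eqmodP/asboolP.
Qed.

Lemma tensor_reprK (x : tensor) : tensor_class (repr x) = x.
Proof. exact: reprK. Qed.

Lemma tensor_repr_eq s : tensor_eq (repr (tensor_class s)) s.
Proof. by apply/tensor_classP; rewrite tensor_reprK. Qed.

Definition tensor_scale_seq a s : seq (M * N) :=
  [seq (a *: p.1, p.2) | p <- s].

Lemma tensor_scale_seq_eq a s t :
  tensor_eq s t -> tensor_eq (tensor_scale_seq a s) (tensor_scale_seq a t).
Proof.
elim=> {s t} /=.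
- by move=> s; apply: TensorRefl.
- by move=> s t _; apply: TensorSym.
- by move=> s t u _ h _; apply: TensorTrans h.
- move=> s s' t t' _ h _ h'; rewrite /tensor_scale_seq !map_cat.
  exact: TensorCat h h'.
- by move=> s t; rewrite /tensor_scale_seq !map_cat; apply: TensorCatC.
- by move=> m m' n; rewrite scalerDr; apply: TensorAddl.
- by move=> m n n'; apply: TensorAddr.
- by move=> b m n; rewrite scalerA mulrC -scalerA; apply: TensorScale.
- by move=> n; rewrite scaler0; apply: TensorZero.
Qed.

Definition tensor_zero : tensor := tensor_class [::].
Definition tensor_add (x y : tensor) : tensor :=
  tensor_class (repr x ++ repr y).
Definition tensor_scale a (x : tensor) : tensor :=
  tensor_class (tensor_scale_seq a (repr x)).
Definition tensor_opp (x : tensor) : tensor := tensor_scale (-1) x.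

Lemma tensor_addE s t :
  tensor_add (tensor_class s) (tensor_class t) = tensor_class (s ++ t).
Proof. by apply/tensor_classP; apply: TensorCat; apply: tensor_repr_eq. Qed.

Lemma tensor_scaleE a s :
  tensor_scale a (tensor_class s) = tensor_class (tensor_scale_seq a s).
Proof.
by apply/tensor_classP; apply: tensor_scale_seq_eq; apply: tensor_repr_eq.
Qed.

Lemma tensor_addA : associative tensor_add.
Proof.
move=> x y z; rewrite -(tensor_reprK x) -(tensor_reprK y) -(tensor_reprK z).
by rewrite !tensor_addE catA.
Qed.

Lemma tensor_addC : commutative tensor_add.
Proof.
move=> x y; rewrite -(tensor_reprK x) -(tensor_reprK y) !tensor_addE.
by apply/tensor_classP; apply: TensorCatC.
Qed.

Lemma tensor_add0 : left_id tensor_zero tensor_add.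
Proof. by move=> x; rewrite -(tensor_reprK x) tensor_addE. Qed.

Lemma tensor_scaleDl x :
  {morph tensor_scale^~ x : a b / a + b >-> tensor_add a b}.
Proof.
move=> a b; rewrite -(tensor_reprK x) !tensor_scaleE tensor_addE.
apply/tensor_classP; elim: (repr x) => [|[m n] s IHs] /=.
  exact: TensorRefl.
rewrite scalerDl -cat1s.
apply: TensorTrans (TensorCat (TensorAddl _ _ _) IHs) _ => /=.
rewrite -[X in tensor_eq X]cat1s -[X in tensor_eq _ X]cat1s.
apply: TensorCat; first exact: TensorRefl.
rewrite -cat1s -[X in tensor_eq _ (_ ++ X)]cat1s !catA.
by apply: TensorCat (TensorCatC _ _) (TensorRefl _).
Qed.

Lemma tensor_scale0 x : tensor_scale 0 x = tensor_zero.
Proof.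
rewrite -(tensor_reprK x) tensor_scaleE; apply/tensor_classP.
elim: (repr x) => [|[m n] s IHs] /=; first exact: TensorRefl.
rewrite scale0r -cat1s.
exact (TensorCat (TensorZero M n) IHs).
Qed.

Lemma tensor_scale1 : left_id 1 tensor_scale.
Proof.
move=> x; rewrite -[RHS]tensor_reprK; congr tensor_class.
by apply: map_id_in => -[m n] _ /=; rewrite scale1r.
Qed.

Lemma tensor_addN : left_inverse tensor_zero tensor_opp tensor_add.
Proof.
move=> x; rewrite -[X in tensor_add _ X]tensor_scale1 -tensor_scaleDl.
by rewrite addNr tensor_scale0.
Qed.

HB.instance Definition _ := GRing.isZmodule.Build tensor
  tensor_addA tensor_addC tensor_add0 tensor_addN.

Lemma tensor_scaleA a b x :
  tensor_scale a (tensor_scale b x) = tensor_scale (a * b) x.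
Proof.
rewrite -(tensor_reprK x) !tensor_scaleE; congr tensor_class.
by rewrite /tensor_scale_seq -map_comp; apply: eq_map => p /=; rewrite scalerA.
Qed.

Lemma tensor_scaleDr : right_distributive tensor_scale +%R.
Proof.
move=> a x y; rewrite -(tensor_reprK x) -(tensor_reprK y).
rewrite [_ + _]tensor_addE !tensor_scaleE [RHS]tensor_addE.
by rewrite /tensor_scale_seq map_cat.
Qed.

HB.instance Definition _ := GRing.Zmodule_isLmodule.Build R tensor
  tensor_scaleA tensor_scale1 tensor_scaleDr tensor_scaleDl.

Definition tens m n : tensor := tensor_class [:: (m, n)].

Lemma tens_bilinear : bilinear_op tens.
Proof.
split=> [n a m m' | m a n n'].
  rewrite [a *: tens _ _]tensor_scaleE [RHS]tensor_addE.
  by apply/tensor_classP; apply: TensorAddl.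
rewrite [a *: tens _ _]tensor_scaleE [RHS]tensor_addE; apply/tensor_classP.
apply: TensorTrans (TensorAddr _ _ _) _.
rewrite -[X in tensor_eq X]cat1s.
apply: TensorCat; last exact: TensorRefl.
by apply: TensorSym; apply: TensorScale.
Qed.

Lemma tensor_sum (x : tensor) : x = \sum_(p <- repr x) tens p.1 p.2.
Proof.
rewrite -[LHS]tensor_reprK; elim: (repr x) => [|[m n] s IHs].
  by rewrite big_nil.
by rewrite big_cons -IHs [RHS]tensor_addE.
Qed.

Lemma tensor_ext (P : lmodType R) (f g : tensor -> P) :
  linear f -> linear g -> (forall m n, f (tens m n) = g (tens m n)) -> f =1 g.
Proof.
move=> lf lg fg x; have f0 : f 0 = g 0.
  have := lf (-1) 0 0; have := lg (-1) 0 0.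
  by rewrite scaler0 addr0 !scaleN1r !addNr => -> ->.
rewrite (tensor_sum x); elim: (repr x) => [|p s IHs]; first by rewrite !big_nil.
by rewrite !big_cons -[tens _ _]scale1r lf lg fg IHs.
Qed.

(* tensor_lift f (\sum_i m_i (x) n_i) = \sum_i f m_i n_i. The definition picks
   a representative; by tensor_lift_linear and tensor_lift_tens it is the
   linear map induced by f as soon as f is bilinear. *)
Definition tensor_lift (P : lmodType R) (f : M -> N -> P) (x : tensor) : P :=
  \sum_(p <- repr x) f p.1 p.2.

Section Lift.
Variables (P : lmodType R) (f : M -> N -> P).
Hypothesis f_bilin : bilinear_op f.

Lemma tensor_lift_eq s t : tensor_eq s t ->
  \sum_(p <- s) f p.1 p.2 = \sum_(p <- t) f p.1 p.2.
Proof.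
case: f_bilin => fl fr.
have flD m m' n : f (m + m') n = f m n + f m' n.
  by rewrite -[m]scale1r fl !scale1r.
have frD m n n' : f m (n + n') = f m n + f m n'.
  by rewrite -[n]scale1r fr !scale1r.
have fl0 n : f 0 n = 0 by apply: (addrI (f 0 n)); rewrite -flD !addr0.
have fr0 m : f m 0 = 0 by apply: (addrI (f m 0)); rewrite -frD !addr0.
elim=> {s t} //.
- by move=> s t u _ -> _ ->.
- by move=> s s' t t' _ IHs _ IHt; rewrite !big_cat /= IHs IHt.
- by move=> s t; rewrite !big_cat /= addrC.
- by move=> m m' n; rewrite !big_cons !big_nil /= !addr0 flD.
- by move=> m n n'; rewrite !big_cons !big_nil /= !addr0 frD.
- move=> a m n; rewrite !big_cons !big_nil /= !addr0.
  rewrite -[a *: m]addr0 -[a *: n]addr0.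
  by rewrite (fl n a m 0) (fr m a n 0) fl0 fr0.
- by move=> n; rewrite big_cons !big_nil /= addr0 fl0.
Qed.

Lemma tensor_lift_class s :
  tensor_lift f (tensor_class s) = \sum_(p <- s) f p.1 p.2.
Proof. by apply: tensor_lift_eq; apply: tensor_repr_eq. Qed.

Lemma tensor_lift_tens m n : tensor_lift f (tens m n) = f m n.
Proof. by rewrite tensor_lift_class big_cons big_nil addr0. Qed.

Lemma tensor_lift_linear : linear (tensor_lift f).
Proof.
case: (f_bilin) => fl _ a x y; have f0 n : f 0 n = 0.
  by have /esym := fl n (-1) 0 0; rewrite scaler0 addr0 scaleN1r addNr.
rewrite -(tensor_reprK x) -(tensor_reprK y) [_ *: _]tensor_scaleE.
rewrite [_ + _]tensor_addE !tensor_lift_class big_cat big_map /= scaler_sumr.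
congr (_ + _); apply: eq_bigr => p _ /=.
by rewrite -[a *: p.1]addr0 (fl p.2 a p.1 0) f0 addr0.
Qed.

End Lift.
End Tensor.

Notation "x \ox y" := (tens x y) (at level 40, left associativity) : ring_scope.

Section InfinitesimalBialgebra.
Variables (R : comPzRingType) (A : lmodType R).
Implicit Types (mu rhd : A -> A -> A) (Delta : A -> tensor A A).

Definition assoc_algebra mu : Prop :=
  bilinear_op mu /\ (forall a b c, mu (mu a b) c = mu a (mu b c)).

(* Delta (x) id and id (x) Delta, both landing in A (x) (A (x) A) through the
   canonical isomorphism (a (x) b) (x) c |-> a (x) (b (x) c). *)
Definition comul_left Delta : tensor A A -> tensor A (tensor A A) :=
  tensor_lift (fun x c => tensor_lift (fun a b => a \ox (b \ox c)) (Delta x)).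

Definition comul_right Delta : tensor A A -> tensor A (tensor A A) :=
  tensor_lift (fun a y => a \ox Delta y).

Definition coassoc_coalgebra Delta : Prop :=
  linear Delta /\
  (forall a, comul_left Delta (Delta a) = comul_right Delta (Delta a)).

Definition lact mu (a : A) : tensor A A -> tensor A A :=
  tensor_lift (fun b c => mu a b \ox c).

Definition ract mu (x : tensor A A) (a : A) : tensor A A :=
  tensor_lift (fun b c => b \ox mu c a) x.

Definition infinitesimal_bialgebra (lambda : R) mu Delta : Prop :=
  [/\ assoc_algebra mu, coassoc_coalgebra Delta &
      forall a b, Delta (mu a b) =
        lact mu a (Delta b) + ract mu (Delta a) b + lambda *: (a \ox b)].

Definition comm_infinitesimal_bialgebra (lambda : R) mu Delta : Prop :=
  infinitesimal_bialgebra lambda mu Delta /\ (forall a b, mu a b = mu b a).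

Definition pre_lie_algebra rhd : Prop :=
  bilinear_op rhd /\
  (forall a b c, rhd (rhd a b) c - rhd a (rhd b c) =
                 rhd (rhd b a) c - rhd b (rhd a c)).

Definition novikov_algebra rhd : Prop :=
  pre_lie_algebra rhd /\
  (forall a b c, rhd (rhd a b) c = rhd (rhd a c) b).

Definition rhd_eps (kappa : R) mu Delta (a b : A) : A :=
  tensor_lift (fun b1 b2 => mu (mu a b1) b2) (Delta b) + kappa *: mu a b.

End InfinitesimalBialgebra.

(* Main.v *)
Require Import Defs.
From mathcomp Require Import all_boot all_order all_algebra.

Set Implicit Arguments.
Unset Strict Implicit.
Unset Printing Implicit Defensive.

Import GRing.Theory.
Local Open Scope ring_scope.

(** Write [D b] for the product of the two legs of [Delta b], that is
    [D = mu o Delta]. Multiplying the legs of the compatibility condition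
    between [mu] and [Delta] shows that [D] is a derivation up to a multiple of
    the product: [D (a b) = a (D b) + (D a) b + lambda (a b)]
    ([comul_product_weighted_derivation]). Adding [kappa] times the identity
    keeps this form and changes the weight to [lambda - kappa], and the
    operation of the theorem is [a > b = a (P b)] for [P = D + kappa id].

    What remains is the construction of Novikov algebras by Gelfand and
    Dorfman, with a weight: for commutative [mu] and a derivation [P] of weight
    [w], the product [(a > b) > c = a (P b) (P c)] is visibly symmetric in [b]
    and [c], and the associator
      [(a > b) > c - a > (b > c) = - (a b (P (P c)) + w (a b (P c)))]
    is symmetric in [a] and [b] because it depends on them only through their
    product ([weighted_derivation_novikov]). *)

Definition weighted_derivation (R : comPzRingType) (A : lmodType R)
    (mu : A -> A -> A) (w : R) (P : A -> A) : Prop :=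
  linear P /\
  forall a b, P (mu a b) = mu a (P b) + mu (P a) b + w *: mu a b.

Section LinearMaps.
Variables (R : comPzRingType) (U V : lmodType R) (f : U -> V).
Hypothesis f_lin : linear f.

Lemma linear_add x y : f (x + y) = f x + f y.
Proof. by rewrite -[x]scale1r f_lin !scale1r. Qed.

Lemma linear_zero : f 0 = 0.
Proof. by apply: (addrI (f 0)); rewrite -linear_add !addr0. Qed.

Lemma linear_scale a x : f (a *: x) = a *: f x.
Proof. by rewrite -[a *: x]addr0 f_lin linear_zero addr0. Qed.

Lemma linear_tensor_lift (M N : lmodType R) (g : M -> N -> U) x :
  f (tensor_lift g x) = tensor_lift (fun m n => f (g m n)) x.
Proof.
rewrite /tensor_lift; elim: (repr x) => [|p s IHs].
  by rewrite !big_nil linear_zero.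
by rewrite !big_cons linear_add IHs.
Qed.

End LinearMaps.

Lemma eq_tensor_lift (R : comPzRingType) (M N P : lmodType R)
    (f g : M -> N -> P) :
  (forall m n, f m n = g m n) -> tensor_lift f =1 tensor_lift g.
Proof. by move=> fg x; apply: eq_bigr => p _; apply: fg. Qed.

Section LegProduct.
Variables (R : comPzRingType) (A : lmodType R) (mu : A -> A -> A).
Hypothesis mu_alg : assoc_algebra mu.

Let mu_bilin : bilinear_op mu := proj1 mu_alg.
Let muA : forall a b c, mu (mu a b) c = mu a (mu b c) := proj2 mu_alg.

Lemma tensor_lift_mulA a x :
  tensor_lift (fun b c => mu (mu a b) c) x = mu a (tensor_lift mu x).
Proof.
rewrite (linear_tensor_lift (proj2 mu_bilin a)).
by apply: eq_tensor_lift => b c; apply: muA.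
Qed.

Lemma tensor_lift_lact a x :
  tensor_lift mu (lact mu a x) = mu a (tensor_lift mu x).
Proof.
rewrite (linear_tensor_lift (tensor_lift_linear mu_bilin)) -tensor_lift_mulA.
by apply: eq_tensor_lift => b c; apply: tensor_lift_tens.
Qed.

Lemma tensor_lift_ract x a :
  tensor_lift mu (ract mu x a) = mu (tensor_lift mu x) a.
Proof.
rewrite (linear_tensor_lift (tensor_lift_linear mu_bilin)).
rewrite (linear_tensor_lift (proj1 mu_bilin a)).
by apply: eq_tensor_lift => b c; rewrite tensor_lift_tens // muA.
Qed.

End LegProduct.

(** The product map carries the two actions on [A (x) A] to left and right
    multiplication, and [a (x) b] to [a b], so it turns the compatibility
    condition of the bialgebra into a Leibniz rule. *)
Lemma comul_product_weighted_derivation (R : comPzRingType) (A : lmodType R)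
    (lambda : R) (mu : A -> A -> A) (Delta : A -> tensor A A) :
  infinitesimal_bialgebra lambda mu Delta ->
  weighted_derivation mu lambda (fun b => tensor_lift mu (Delta b)).
Proof.
case=> mu_alg [Delta_lin _] compat.
have lift_lin := tensor_lift_linear (proj1 mu_alg).
split=> [a x y | a b]; first by rewrite Delta_lin lift_lin.
rewrite compat !(linear_add lift_lin) (linear_scale lift_lin).
by rewrite tensor_lift_lact // tensor_lift_ract // tensor_lift_tens //; case: mu_alg.
Qed.

Section GelfandDorfman.
Variables (R : comPzRingType) (A : lmodType R) (mu : A -> A -> A).
Hypothesis mu_alg : assoc_algebra mu.

Let mu_bilin : bilinear_op mu := proj1 mu_alg.
Let muA : forall a b c, mu (mu a b) c = mu a (mu b c) := proj2 mu_alg.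

(** The two terms [a (kappa b)] and [(kappa a) b] of the Leibniz rule contain
    [kappa (a b)] twice, but [P (a b)] contains it only once: the weight drops
    by [kappa]. *)
Lemma weighted_derivation_shift w D kappa :
  weighted_derivation mu w D ->
  weighted_derivation mu (w - kappa) (fun b => D b + kappa *: b).
Proof.
case: mu_bilin => mul mur [D_lin DM]; split=> [a x y | a b].
  rewrite D_lin !scalerDr !scalerA (mulrC kappa) !addrA; congr (_ + _).
  by rewrite -!addrA; congr (_ + _); apply: addrC.
rewrite DM (linear_add (mur a)) (linear_scale (mur a)).
rewrite (linear_add (mul b)) (linear_scale (mul b)).
rewrite scalerBl -!addrA; congr (_ + _).
rewrite [RHS]addrCA; congr (_ + _).
by rewrite subrKC addrC.
Qed.

Hypothesis muC : forall a b, mu a b = mu b a.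

Lemma weighted_derivation_novikov w P :
  weighted_derivation mu w P -> novikov_algebra (fun a b => mu a (P b)).
Proof.
case: mu_bilin => mul mur [P_lin PM].
have associator a b c : mu (mu a (P b)) (P c) - mu a (P (mu b (P c))) =
    - (mu (mu a b) (P (P c)) + w *: mu (mu a b) (P c)).
  rewrite PM !(linear_add (mur a)) (linear_scale (mur a)) !muA.
  by rewrite [_ + mu a (mu (P b) _)]addrC -addrA opprD addrA subrr add0r.
split; last by move=> a b c; rewrite !muA [mu (P b) _]muC.
split; last by move=> a b c; rewrite !associator (muC a b).
by split=> [b | a c x y]; [apply: mul | rewrite P_lin mur].
Qed.

End GelfandDorfman.

Lemma rhd_epsE (R : comPzRingType) (A : lmodType R) (kappa : R)
    (mu : A -> A -> A) (Delta : A -> tensor A A) :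
  assoc_algebra mu -> forall a b,
  rhd_eps kappa mu Delta a b = mu a (tensor_lift mu (Delta b) + kappa *: b).
Proof.
move=> mu_alg a b; have mur := proj2 (proj1 mu_alg) a.
by rewrite /rhd_eps tensor_lift_mulA // (linear_add mur) (linear_scale mur).
Qed.

Lemma eq_novikov_algebra (R : comPzRingType) (A : lmodType R)
    (f g : A -> A -> A) :
  (forall a b, f a b = g a b) -> novikov_algebra g -> novikov_algebra f.
Proof.
move=> fg [[[gl gr] gP] gN]; split; last by move=> a b c; rewrite !fg gN.
split; last by move=> a b c; rewrite !fg gP.
by split=> [v a x y | v a x y]; rewrite !fg ?gl ?gr.
Qed.

Theorem corollary5p10 (k : comPzRingType) (kappa lambda : k) (A : lmodType k)
    (mu : A -> A -> A) (Delta : A -> tensor A A)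
    (hA : comm_infinitesimal_bialgebra lambda mu Delta) :
  pre_lie_algebra (rhd_eps kappa mu Delta) /\
  novikov_algebra (rhd_eps kappa mu Delta).
Proof.
case: hA => bialg muC; have [mu_alg _ _] := bialg.
suff nov : novikov_algebra (rhd_eps kappa mu Delta) by split; first exact: proj1 nov.
apply: (eq_novikov_algebra (rhd_epsE kappa Delta mu_alg)).
apply: (weighted_derivation_novikov mu_alg muC (w := lambda - kappa)).
apply: weighted_derivation_shift mu_alg _ _ _ _.
exact: comul_product_weighted_derivation bialg.
Qed.
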